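(* Let $f_1,f_2:\mathbb{R}^2\to\mathbb{R}$ and consider the control system on $\mathbb{R}^3$ with state $(x_1,x_2,x_3)$ and inputs $u_1,u_2$, $$\dot{x}_1=u_1,\quad \dot{x}_2=u_2,\quad \dot{x}_3=f_1(x_1,x_2)u_1+f_2(x_1,x_2)u_2.$$ Define $F:\mathbb{C}\to\mathbb{C}$ by $F(x_1+ix_2)=f_2(x_1,x_2)+if_1(x_1,x_2)$. If $F$ is holomorphic, then the system is uncontrollable.
   Context: A function $F:\mathbb{C}\to\mathbb{C}$ is holomorphic if it is complex differentiable at each point of $\mathbb{C}$. The system is controllable if for every pair of states $p,q\in\mathbb{R}^3$ there exist a finite time $T>0$ and piecewise continuous real-valued inputs on $[0,T]$ whose corresponding trajectory starts at $p$ at time $0$ and is at $q$ at time $T$; it is uncontrollable if it is not controllable. *)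

(* Defs.v *)
From Stdlib Require Export Reals List.
From Coquelicot Require Export Coquelicot.
Open Scope R_scope.

(* Differentiability is over the field C, as forced by the type C -> C. *)
Definition holomorphic (F : C -> C) : Prop := forall z : C, ex_derive F z.

(* Only the restriction of u to [a, b] matters, and its values at the
   breakpoints are arbitrary. *)
Definition piecewise_continuous (u : R -> R) (a b : R) : Prop :=
  exists (n : nat) (tau : nat -> R),
    tau 0%nat = a /\ tau n = b /\
    forall i : nat, (i < n)%nat ->
      tau i < tau (S i) /\
      (forall t : R, tau i < t < tau (S i) -> continuous u t) /\
      (exists l : R, filterlim u (at_right (tau i)) (locally l)) /\
      (exists l : R, filterlim u (at_left (tau (S i))) (locally l)).

(* Since the inputs may jump, the differential equation is required outside a
   finite set of times, the state being continuous on all of [0, T]. *)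
Definition trajectory (f1 f2 : R -> R -> R) (T : R) (u1 u2 x1 x2 x3 : R -> R)
  : Prop :=
  continuous_on (fun t => 0 <= t <= T) x1 /\
  continuous_on (fun t => 0 <= t <= T) x2 /\
  continuous_on (fun t => 0 <= t <= T) x3 /\
  exists E : list R, forall t : R, 0 < t < T -> ~ In t E ->
    is_derive x1 t (u1 t) /\
    is_derive x2 t (u2 t) /\
    is_derive x3 t (f1 (x1 t) (x2 t) * u1 t + f2 (x1 t) (x2 t) * u2 t).

Definition controllable (f1 f2 : R -> R -> R) : Prop :=
  forall p q : R * R * R,
  exists (T : R) (u1 u2 x1 x2 x3 : R -> R),
    0 < T /\
    piecewise_continuous u1 0 T /\
    piecewise_continuous u2 0 T /\
    trajectory f1 f2 T u1 u2 x1 x2 x3 /\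
    (x1 0, x2 0, x3 0) = p /\
    (x1 T, x2 T, x3 T) = q.

Definition uncontrollable (f1 f2 : R -> R -> R) : Prop :=
  ~ controllable f1 f2.

(* Main.v *)
Require Import Defs.
From Stdlib Require Import Reals.
From Coquelicot Require Import Coquelicot.
From Stdlib Require Import Lra Lia IndefiniteDescription.

(** The third equation of the system reads dx3 = f1 dx1 + f2 dx2, where the
    right-hand side is the imaginary part of F(z) dz.  The Cauchy-Riemann
    equations say precisely that this 1-form is closed, so on the plane it has
    a potential phi, and x3 - phi(x1, x2) is constant along every trajectory.
    A conserved quantity forbids controllability: (0, 0, 0) and (0, 0, 1) have
    the same first two coordinates and lie on different level surfaces.

    Complex differentiability gives no continuity of the partial derivatives,
    so Green's formula cannot be used to produce phi.  Instead [goursat] runs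
    Goursat's bisection argument on rectangles: if the integral around some
    rectangle were nonzero, repeated quartering would yield a nested sequence
    of rectangles on which the integral is at least proportional to the area,
    while [circulation_local] says that near the common point it is
    negligible compared with the area.  Hence integrating along a horizontal
    and then a vertical segment, or in the other order, gives the same result,
    which yields the potential and its differential
    ([potential_differentiable]).

    Inputs may jump, so the conserved quantity has zero derivative only off a
    finite set; being continuous, it is still constant
    ([eq_of_derive_zero], [trajectory_invariant]). *)

(** * Closed forms and integrals over rectangles *)

(** Closedness of P dx + Q dy is taken pointwise, because continuity of the
    partial derivatives is not available for a holomorphic function before
    Goursat's lemma. *)
Definition closed_form (P Q : R -> R -> R) : Prop :=
  forall x y, exists px c qy,
    differentiable_pt_lim P x y px c /\ differentiable_pt_lim Q x y c qy.

(** Integral of P dx + Q dy along the boundary of the rectangle, taken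
    counterclockwise when [a <= b] and [c <= d]. *)
Definition circulation (P Q : R -> R -> R) (a b c d : R) : R :=
  RInt (fun s => P s c) a b + RInt (fun t => Q b t) c d
  - RInt (fun s => P s d) a b - RInt (fun t => Q a t) c d.

Lemma ex_RInt_of_continuous (g : R -> R) (a b : R) :
  (forall s, continuous g s) -> ex_RInt g a b.
Proof.
  intros Hg; apply (ex_RInt_continuous (V := R_CompleteNormedModule)); auto.
Qed.

Lemma RInt_add (g : R -> R) (a b c : R) :
  (forall s, continuous g s) -> RInt g a b + RInt g b c = RInt g a c.
Proof.
  intros Hg.
  exact (RInt_Chasles g a b c (ex_RInt_of_continuous g a b Hg) (ex_RInt_of_continuous g b c Hg)).
Qed.

Lemma RInt_reverse (g : R -> R) (a b : R) :
  (forall s, continuous g s) -> RInt g a b = - RInt g b a.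
Proof.
  intros Hg.
  exact (eq_sym (opp_RInt_swap g b a (ex_RInt_of_continuous g b a Hg))).
Qed.

Lemma RInt_sub (g1 g2 : R -> R) (a b : R) :
  (forall s, continuous g1 s) -> (forall s, continuous g2 s) ->
  RInt (fun s => g1 s - g2 s) a b = RInt g1 a b - RInt g2 a b.
Proof.
  intros H1 H2.
  exact (RInt_minus g1 g2 a b (ex_RInt_of_continuous g1 a b H1) (ex_RInt_of_continuous g2 a b H2)).
Qed.

(** The bounds may come in either order, as needed for the increments of the
    potential. *)
Lemma RInt_near_const (g : R -> R) (m e a b : R) :
  (forall s, continuous g s) ->
  (forall s, Rmin a b <= s <= Rmax a b -> Rabs (g s - m) <= e) ->
  Rabs (RInt g a b - m * (b - a)) <= e * Rabs (b - a).
Proof.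
  assert (W : forall a b, a <= b -> (forall s, continuous g s) ->
    (forall s, a <= s <= b -> Rabs (g s - m) <= e) ->
    Rabs (RInt g a b - m * (b - a)) <= e * (b - a)).
  { intros a' b' Hab Hg He.
    assert (Hm : ex_RInt (fun _ : R => m) a' b') by apply ex_RInt_const.
    assert (E : RInt (fun s => g s - m) a' b' = RInt g a' b' - m * (b' - a')).
    { rewrite (RInt_sub g (fun _ => m) a' b' Hg (fun s => continuous_const m s)).
      rewrite RInt_const. unfold scal; simpl. unfold mult; simpl. ring. }
    rewrite <- E, Rmult_comm.
    apply abs_RInt_le_const; trivial.
    exact (ex_RInt_minus g (fun _ => m) a' b' (ex_RInt_of_continuous g a' b' Hg) Hm). }
  intros Hg He. destruct (Rle_dec a b) as [H | H].
  - rewrite (Rabs_pos_eq (b - a)) by lra. apply W; trivial.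
    intros s Hs; apply He. rewrite Rmin_left, Rmax_right; lra.
  - replace (RInt g a b - m * (b - a)) with (- (RInt g b a - m * (a - b))).
    + rewrite Rabs_Ropp, (Rabs_left (b - a)) by lra.
      replace (- (b - a)) with (a - b) by ring. apply W; trivial; try lra.
      intros s Hs; apply He. rewrite Rmin_right, Rmax_left; lra.
    + rewrite (RInt_reverse g a b Hg). ring.
Qed.

Lemma continuous_slice_x (P : R -> R -> R) (y : R) :
  (forall x y, continuity_2d_pt P x y) -> forall s : R, continuous (fun s : R => P s y) s.
Proof.
  intros HP s. apply continuity_pt_filterlim. apply continuity_pt_locally.
  intros eps. destruct (HP s y eps) as [d Hd]. exists d.
  intros u Hu. apply Hd; [exact Hu | rewrite Rminus_eq_0, Rabs_R0; apply cond_pos].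
Qed.

Lemma continuous_slice_y (P : R -> R -> R) (x : R) :
  (forall x y, continuity_2d_pt P x y) -> forall t : R, continuous (fun t : R => P x t) t.
Proof.
  intros HP t. apply continuity_pt_filterlim. apply continuity_pt_locally.
  intros eps. destruct (HP x t eps) as [d Hd]. exists d.
  intros u Hu. apply Hd; [rewrite Rminus_eq_0, Rabs_R0; apply cond_pos | exact Hu].
Qed.

Lemma closed_form_continuous (P Q : R -> R -> R) :
  closed_form P Q ->
  (forall x y, continuity_2d_pt P x y) /\ (forall x y, continuity_2d_pt Q x y).
Proof.
  intros H; split; intros x y; destruct (H x y) as (px & c & qy & HP & HQ);
    apply differentiable_continuity_pt; eexists; eexists; eassumption.
Qed.

(** * Goursat's lemma *)

(** Opposite sides are compared in pairs.  To first order, the difference of P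
    between top and bottom is [m * k] and that of Q between right and left is
    [m * h], with the same [m] because the form is closed; the two
    contributions [m * h * k] cancel, leaving the remainders. *)
Lemma circulation_local (P Q : R -> R -> R) (x y : R) (e : posreal) :
  closed_form P Q ->
  exists delta : posreal, forall a h c k,
    0 <= h -> 0 <= k -> h + k < delta -> a <= x <= a + h -> c <= y <= c + k ->
    Rabs (circulation P Q a (a + h) c (c + k)) <= 2 * e * (h + k) ^ 2.
Proof.
  intros Hcl. destruct (closed_form_continuous P Q Hcl) as [CP CQ].
  destruct (Hcl x y) as (px & m & qy & HP & HQ).
  destruct (HP e) as [d1 H1]. destruct (HQ e) as [d2 H2].
  exists (mkposreal _ (Rmin_stable_in_posreal d1 d2)); simpl.
  intros a h c k Hh Hk Hd Hx Hy.
  assert (Hd1 := Rmin_l d1 d2). assert (Hd2 := Rmin_r d1 d2).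
  assert (He := cond_pos e).
  assert (B : forall u v, a <= u <= a + h -> c <= v <= c + k ->
    Rabs (u - x) < Rmin d1 d2 /\ Rabs (v - y) < Rmin d1 d2 /\
    e * Rmax (Rabs (u - x)) (Rabs (v - y)) <= e * (h + k)).
  { intros u v Hu Hv.
    assert (Rabs (u - x) <= h) by (apply Rabs_le; lra).
    assert (Rabs (v - y) <= k) by (apply Rabs_le; lra).
    repeat split; try lra.
    apply Rmult_le_compat_l; [lra |]. apply Rmax_lub; lra. }
  assert (EP : forall u v, a <= u <= a + h -> c <= v <= c + k ->
    Rabs (P u v - P x y - (px * (u - x) + m * (v - y))) <= e * (h + k)).
  { intros u v Hu Hv. destruct (B u v Hu Hv) as (B1 & B2 & B3).
    eapply Rle_trans; [apply H1; lra | exact B3]. }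
  assert (EQ : forall u v, a <= u <= a + h -> c <= v <= c + k ->
    Rabs (Q u v - Q x y - (m * (u - x) + qy * (v - y))) <= e * (h + k)).
  { intros u v Hu Hv. destruct (B u v Hu Hv) as (B1 & B2 & B3).
    eapply Rle_trans; [apply H2; lra | exact B3]. }
  assert (CPs := fun v => continuous_slice_x P v CP).
  assert (CQs := fun u => continuous_slice_y Q u CQ).
  assert (FP : Rabs (RInt (fun s => P s (c + k) - P s c) a (a + h)
                     - (m * k) * (a + h - a)) <= 2 * e * (h + k) * Rabs (a + h - a)).
  { apply RInt_near_const.
    - intros s. exact (continuous_minus (fun s => P s (c + k)) (fun s => P s c) s
        (CPs (c + k) s) (CPs c s)).
    - intros s. rewrite Rmin_left, Rmax_right by lra. intros Hs.
      assert (E1 := EP s (c + k) Hs ltac:(lra)).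
      assert (E2 := EP s c Hs ltac:(lra)).
      apply Rabs_le_between in E1. apply Rabs_le_between in E2.
      apply Rabs_le. lra. }
  assert (FQ : Rabs (RInt (fun t => Q (a + h) t - Q a t) c (c + k)
                     - (m * h) * (c + k - c)) <= 2 * e * (h + k) * Rabs (c + k - c)).
  { apply RInt_near_const.
    - intros t. exact (continuous_minus (fun t => Q (a + h) t) (fun t => Q a t) t
        (CQs (a + h) t) (CQs a t)).
    - intros t. rewrite Rmin_left, Rmax_right by lra. intros Ht.
      assert (E1 := EQ (a + h) t ltac:(lra) Ht).
      assert (E2 := EQ a t ltac:(lra) Ht).
      apply Rabs_le_between in E1. apply Rabs_le_between in E2.
      apply Rabs_le. lra. }
  rewrite (RInt_sub (fun s => P s (c + k)) (fun s => P s c)) in FP by auto.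
  rewrite (RInt_sub (fun t => Q (a + h) t) (fun t => Q a t)) in FQ by auto.
  rewrite (Rabs_pos_eq (a + h - a)) in FP by lra.
  rewrite (Rabs_pos_eq (c + k - c)) in FQ by lra.
  apply Rabs_le_between in FP. apply Rabs_le_between in FQ.
  unfold circulation. apply Rabs_le. simpl. lra.
Qed.

Lemma circulation_split (P Q : R -> R -> R) (a b m c d n : R) :
  closed_form P Q ->
  circulation P Q a b c d =
  circulation P Q a m c n + circulation P Q m b c n
  + circulation P Q a m n d + circulation P Q m b n d.
Proof.
  intros Hcl. destruct (closed_form_continuous P Q Hcl) as [CP CQ].
  assert (CPs := fun v => RInt_add _ a m b (continuous_slice_x P v CP)).
  assert (CQs := fun u => RInt_add _ c n d (continuous_slice_y Q u CQ)).
  unfold circulation.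
  rewrite <- (CPs c), <- (CPs d), <- (CQs a), <- (CQs b). ring.
Qed.

(** In each coordinate, the lower corner moves within the first half of the
    previous side, so the nested intervals have a common point. *)
Lemma nested_halving (a : nat -> R) (h : R) :
  (forall n, a n <= a (S n) <= a n + h * (/ 2) ^ S n) ->
  exists x, forall n, a n <= x <= a n + h * (/ 2) ^ n.
Proof.
  intros Ha.
  assert (Hh : 0 <= h) by (generalize (Ha 0%nat); simpl; lra).
  assert (Hp : forall n, 0 <= h * (/ 2) ^ n)
    by (intros n; apply Rmult_le_pos; [exact Hh | apply pow_le; lra]).
  assert (Hmono : forall n k, a n <= a (n + k)%nat).
  { intros n k; induction k as [| k IH].
    - rewrite Nat.add_0_r; lra.
    - rewrite Nat.add_succ_r. generalize (Ha (n + k)%nat); lra. }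
  assert (Hanti : forall n k,
    a (n + k)%nat + h * (/ 2) ^ (n + k) <= a n + h * (/ 2) ^ n).
  { intros n k; induction k as [| k IH].
    - rewrite Nat.add_0_r; lra.
    - rewrite Nat.add_succ_r. generalize (Ha (n + k)%nat); simpl; lra. }
  assert (Hub : forall m n, a m <= a n + h * (/ 2) ^ n).
  { intros m n. destruct (Nat.le_ge_cases m n) as [H | H].
    - replace n with (m + (n - m))%nat by lia.
      generalize (Hmono m (n - m)%nat) (Hp (m + (n - m))%nat); lra.
    - generalize (Hanti n (m - n)%nat) (Hp (n + (m - n))%nat).
      replace (n + (m - n))%nat with m by lia. lra. }
  destruct (completeness (fun r => exists n, r = a n)) as [x [Hx1 Hx2]].
  - exists (a 0%nat + h * (/ 2) ^ 0). intros r [n ->]. apply Hub.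
  - exists (a 0%nat); exists 0%nat; reflexivity.
  - exists x. intros n; split.
    + apply Hx1. exists n; reflexivity.
    + apply Hx2. intros r [m ->]. apply Hub.
Qed.

Lemma Rabs_quarter (w m1 m2 m3 m4 : R) :
  4 * w <= Rabs (m1 + m2 + m3 + m4) ->
  w <= Rabs m1 \/ w <= Rabs m2 \/ w <= Rabs m3 \/ w <= Rabs m4.
Proof.
  intros H.
  generalize (Rabs_triang (m1 + m2 + m3) m4) (Rabs_triang (m1 + m2) m3)
    (Rabs_triang m1 m2); intros.
  destruct (Rle_dec w (Rabs m1)); [tauto |].
  destruct (Rle_dec w (Rabs m2)); [tauto |].
  destruct (Rle_dec w (Rabs m3)); [tauto |].
  right; right; right. lra.
Qed.

(** Scaling both sides by [r n = 2^-n] keeps the shape of the cells, so a cell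
    carries [w * r n ^ 2] of circulation where [circulation_local] allows
    [2 * e * (h + k) ^ 2 * r n ^ 2]; a small [e] makes these incompatible. *)
Lemma goursat_nonneg (P Q : R -> R -> R) (a h c k : R) :
  closed_form P Q -> 0 <= h -> 0 <= k ->
  circulation P Q a (a + h) c (c + k) = 0.
Proof.
  intros Hcl Hh Hk.
  destruct (Req_dec (circulation P Q a (a + h) c (c + k)) 0) as [E | Hne];
    [exact E | exfalso].
  set (w := Rabs (circulation P Q a (a + h) c (c + k))).
  assert (Hw : 0 < w) by (apply Rabs_pos_lt; exact Hne).
  pose (r := fun n : nat => (/ 2) ^ n).
  assert (Hr : forall n, 0 < r n) by (intros n; apply pow_lt; lra).
  assert (Hr2 : forall n, r n = r (S n) + r (S n)) by (intros n; unfold r; simpl; lra).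
  pose (cell := fun (n : nat) (p : R * R) =>
    circulation P Q (fst p) (fst p + h * r n) (snd p) (snd p + k * r n)).
  (* The circulation does not shrink faster than the area: of the four
     quarters of a bad cell, one is again bad. *)
  pose (bad := fun n p => w * r n ^ 2 <= Rabs (cell n p)).
  assert (Hstep : forall s : nat * (R * R), exists q : R * R,
    bad (fst s) (snd s) ->
    bad (S (fst s)) q /\
    fst (snd s) <= fst q <= fst (snd s) + h * r (S (fst s)) /\
    snd (snd s) <= snd q <= snd (snd s) + k * r (S (fst s))).
  { intros [n [u v]]; simpl fst; simpl snd.
    destruct (Rle_dec (w * r n ^ 2) (Rabs (cell n (u, v)))) as [Hb | Hb];
      [| exists (0, 0); intros H; elim (Hb H)].
    assert (Hh' : 0 <= h * r (S n)) by (apply Rmult_le_pos; [lra | apply Rlt_le, Hr]).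
    assert (Hk' : 0 <= k * r (S n)) by (apply Rmult_le_pos; [lra | apply Rlt_le, Hr]).
    assert (Hb4 : 4 * (w * r (S n) ^ 2) <= Rabs (cell n (u, v)))
      by (rewrite Hr2 in Hb; lra).
    unfold cell in Hb4; simpl fst in Hb4; simpl snd in Hb4.
    rewrite (circulation_split P Q u _ (u + h * r (S n)) v _ (v + k * r (S n)) Hcl)
      in Hb4.
    replace (u + h * r n) with (u + h * r (S n) + h * r (S n)) in Hb4
      by (rewrite (Hr2 n); ring).
    replace (v + k * r n) with (v + k * r (S n) + k * r (S n)) in Hb4
      by (rewrite (Hr2 n); ring).
    destruct (Rabs_quarter _ _ _ _ _ Hb4) as [H | [H | [H | H]]].
    - exists (u, v); intros _; split; [exact H | simpl fst; simpl snd; lra].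
    - exists (u + h * r (S n), v); intros _; split; [exact H | simpl fst; simpl snd; lra].
    - exists (u, v + k * r (S n)); intros _; split; [exact H | simpl fst; simpl snd; lra].
    - exists (u + h * r (S n), v + k * r (S n)); intros _; split;
        [exact H | simpl fst; simpl snd; lra]. }
  destruct (functional_choice _ Hstep) as [next Hnext].
  pose (corner := fix corner (n : nat) : R * R :=
    match n with O => (a, c) | S n => next (n, corner n) end).
  assert (Hbad : forall n, bad n (corner n)).
  { intros n; induction n as [| n IH].
    - unfold bad, cell, r; simpl. rewrite !Rmult_1_r. fold w. lra.
    - exact (proj1 (Hnext (n, corner n) IH)). }
  destruct (nested_halving (fun n => fst (corner n)) h) as [x Hx].
  { intros n. exact (proj1 (proj2 (Hnext (n, corner n) (Hbad n)))). }
  destruct (nested_halving (fun n => snd (corner n)) k) as [y Hy].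
  { intros n. exact (proj2 (proj2 (Hnext (n, corner n) (Hbad n)))). }
  assert (He : exists e : posreal, 2 * e * (h + k) ^ 2 < w).
  { assert (Hden : 0 < 2 * (h + k) ^ 2 + 1) by nra.
    pose (e := w / (2 * (h + k) ^ 2 + 1)).
    assert (He : 0 < e) by exact (Rdiv_lt_0_compat _ _ Hw Hden).
    assert (E : e * (2 * (h + k) ^ 2 + 1) = w)
      by (unfold e; field; apply Rgt_not_eq, Hden).
    exists (mkposreal e He). simpl pos. clearbody e. lra. }
  destruct He as [e He].
  destruct (circulation_local P Q x y e Hcl) as [delta Hloc].
  destruct (pow_lt_1_zero (/ 2) ltac:(rewrite Rabs_pos_eq; lra)
    (delta / (h + k + 1))) as [n Hn].
  { apply Rdiv_lt_0_compat; [apply cond_pos | lra]. }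
  specialize (Hn n (le_n n)). fold (r n) in Hn.
  rewrite Rabs_pos_eq in Hn by (apply Rlt_le, Hr).
  assert (Hsmall : h * r n + k * r n < delta).
  { apply Rmult_lt_compat_l with (r := h + k + 1) in Hn; [| lra].
    replace ((h + k + 1) * (delta / (h + k + 1))) with (pos delta) in Hn
      by (field; lra).
    generalize (Hr n); lra. }
  assert (Hrn := Hr n).
  assert (L := Hloc (fst (corner n)) (h * r n) (snd (corner n)) (k * r n)
    ltac:(nra) ltac:(nra) Hsmall (Hx n) (Hy n)).
  assert (Hb := Hbad n). unfold bad, cell in Hb.
  assert (Hle := Rle_trans _ _ _ Hb L).
  apply (Rmult_lt_compat_r (r n ^ 2)) in He; [| apply pow_lt; exact Hrn].
  replace (2 * e * (h + k) ^ 2 * r n ^ 2)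
    with (2 * e * (h * r n + k * r n) ^ 2) in He by ring.
  lra.
Qed.

(** Arbitrary orientation of the sides is what the potential needs, since it
    is based at the origin. *)
Lemma goursat (P Q : R -> R -> R) (a b c d : R) :
  closed_form P Q -> circulation P Q a b c d = 0.
Proof.
  intros Hcl. destruct (closed_form_continuous P Q Hcl) as [CP CQ].
  assert (W : forall a b c d, a <= b -> c <= d -> circulation P Q a b c d = 0).
  { intros a' b' c' d' H1 H2.
    generalize (goursat_nonneg P Q a' (b' - a') c' (d' - c') Hcl).
    replace (a' + (b' - a')) with b' by ring.
    replace (c' + (d' - c')) with d' by ring. intros H; apply H; lra. }
  assert (SP := fun u v y => RInt_reverse _ u v (continuous_slice_x P y CP)).
  assert (SQ := fun u v x => RInt_reverse _ u v (continuous_slice_y Q x CQ)).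
  assert (X : forall a b c d, circulation P Q a b c d = - circulation P Q b a c d).
  { intros a' b' c' d'. unfold circulation.
    rewrite (SP a' b' c'), (SP a' b' d'). ring. }
  assert (Y : forall a b c d, circulation P Q a b c d = - circulation P Q a b d c).
  { intros a' b' c' d'. unfold circulation.
    rewrite (SQ c' d' a'), (SQ c' d' b'). ring. }
  destruct (Rle_dec a b) as [H1 | H1], (Rle_dec c d) as [H2 | H2].
  - apply W; lra.
  - rewrite Y, W; lra.
  - rewrite X, W; lra.
  - rewrite X, Y, W; lra.
Qed.

(** * The potential of a closed form *)

Definition potential (P Q : R -> R -> R) (x y : R) : R :=
  RInt (fun s => P s 0) 0 x + RInt (fun t => Q x t) 0 y.

(** The circulation around the rectangle with corners [(x, 0)] and [(u, y)]
    vanishes, which moves the horizontal path from height 0 up to height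
    [y]. *)
Lemma potential_increment (P Q : R -> R -> R) (x y u v : R) :
  closed_form P Q ->
  potential P Q u v - potential P Q x y =
  RInt (fun s => P s y) x u + RInt (fun t => Q u t) y v.
Proof.
  intros Hcl. destruct (closed_form_continuous P Q Hcl) as [CP CQ].
  assert (G := goursat P Q x u 0 y Hcl). unfold circulation in G.
  unfold potential.
  rewrite <- (RInt_add _ 0 x u (continuous_slice_x P 0 CP)).
  rewrite <- (RInt_add _ 0 y v (continuous_slice_y Q u CQ)). lra.
Qed.

Lemma potential_differentiable (P Q : R -> R -> R) (x y : R) :
  closed_form P Q -> differentiable_pt_lim (potential P Q) x y (P x y) (Q x y).
Proof.
  intros Hcl eps. destruct (closed_form_continuous P Q Hcl) as [CP CQ].
  destruct (CP x y (pos_div_2 eps)) as [d1 H1].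
  destruct (CQ x y (pos_div_2 eps)) as [d2 H2].
  simpl in H1, H2.
  exists (mkposreal _ (Rmin_stable_in_posreal d1 d2)); simpl.
  intros u v Hu Hv.
  assert (Hd1 := Rmin_l d1 d2). assert (Hd2 := Rmin_r d1 d2).
  assert (He := cond_pos eps).
  assert (Btw : forall p q s, Rmin p q <= s <= Rmax p q -> Rabs (s - p) <= Rabs (q - p)).
  { intros p q s. unfold Rmin, Rmax; destruct (Rle_dec p q); intros Hs.
    - rewrite !Rabs_pos_eq; lra.
    - rewrite !Rabs_left1; lra. }
  rewrite (potential_increment P Q x y u v Hcl).
  assert (EP := RInt_near_const (fun s => P s y) (P x y) (eps / 2) x u
    (continuous_slice_x P y CP)).
  assert (EQ := RInt_near_const (fun t => Q u t) (Q x y) (eps / 2) y v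
    (continuous_slice_y Q u CQ)).
  assert (EP' := EP ltac:(intros s Hs; apply Rlt_le, H1;
    [generalize (Btw _ _ _ Hs); lra
    | rewrite Rminus_eq_0, Rabs_R0; apply cond_pos])).
  assert (EQ' := EQ ltac:(intros t Ht; apply Rlt_le, H2;
    [lra | generalize (Btw _ _ _ Ht); lra])).
  assert (M1 := Rmax_l (Rabs (u - x)) (Rabs (v - y))).
  assert (M2 := Rmax_r (Rabs (u - x)) (Rabs (v - y))).
  set (M := Rmax (Rabs (u - x)) (Rabs (v - y))) in *.
  apply Rle_trans with (eps / 2 * Rabs (u - x) + eps / 2 * Rabs (v - y)).
  - eapply Rle_trans; [| apply Rplus_le_compat; [exact EP' | exact EQ']].
    eapply Rle_trans; [| apply Rabs_triang]. right; f_equal; ring.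
  - nra.
Qed.

(** * Conserved quantity of the control system *)

(** If [(p, q)] is the complex derivative, multiplication by it sends
    [(dx, dy)] to [(p dx - q dy, q dx + p dy)]; the real part concerns [f2]
    and the imaginary part [f1], so [p] is both df1/dy and df2/dx. *)
Lemma holomorphic_closed_form (f1 f2 : R -> R -> R) (F : C -> C) :
  (forall x1 x2 : R, F (x1 + Ci * x2)%C = (f2 x1 x2 + Ci * f1 x1 x2)%C) ->
  holomorphic F -> closed_form f1 f2.
Proof.
  intros HF Hol x y.
  destruct (Hol (x, y)) as [[p q] [_ HD]].
  specialize (HD (x, y) (fun P H => H)).
  assert (HF' : forall u v, F (u, v) = (f2 u v, f1 u v)).
  { intros u v. replace (u, v) with (u + Ci * v)%C.
    - rewrite HF. unfold Cplus, Cmult, Ci, RtoC; simpl. f_equal; ring.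
    - unfold Cplus, Cmult, Ci, RtoC; simpl. f_equal; ring. }
  assert (K : forall eps : posreal, locally_2d (fun u v =>
    Rabs (f2 u v - f2 x y - (p * (u - x) + - q * (v - y)))
      <= eps * Rmax (Rabs (u - x)) (Rabs (v - y)) /\
    Rabs (f1 u v - f1 x y - (q * (u - x) + p * (v - y)))
      <= eps * Rmax (Rabs (u - x)) (Rabs (v - y))) x y).
  { intros eps.
    assert (He : 0 < eps / 2) by (generalize (cond_pos eps); lra).
    apply locally_2d_locally.
    generalize (proj2 (locally_C _ _) (HD (mkposreal _ He))). apply filter_imp.
    intros [u v]. simpl fst; simpl snd.
    change (norm ?z) with (Cmod z). simpl pos. rewrite !HF'.
    set (z := minus _ _) at 1. set (dz := minus _ _).
    intros H.
    assert (M := Rmax_Cmod z).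
    assert (M2 := Cmod_2Rmax dz).
    (* The modulus is at most twice the maximum of the coordinates, which
       accounts for the [eps / 2] above. *)
    assert (S2 : sqrt 2 <= 2).
    { apply Rle_trans with (sqrt 4); [apply sqrt_le_1_alt; lra |].
      replace 4 with (2 * 2) by ring. rewrite sqrt_square; lra. }
    assert (A1 := Rmax_l (Rabs (fst z)) (Rabs (snd z))).
    assert (A2 := Rmax_r (Rabs (fst z)) (Rabs (snd z))).
    assert (Ed : fst dz = u - x /\ snd dz = v - y) by (split; reflexivity).
    destruct Ed as [Ed1 Ed2]. rewrite Ed1, Ed2 in M2.
    assert (Ez1 : fst z = f2 u v - f2 x y - (p * (u - x) + - q * (v - y))).
    { unfold z, minus, plus, opp, scal; simpl. unfold mult; simpl. ring. }
    assert (Ez2 : snd z = f1 u v - f1 x y - (q * (u - x) + p * (v - y))).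
    { unfold z, minus, plus, opp, scal; simpl. unfold mult; simpl. ring. }
    rewrite <- Ez1, <- Ez2.
    set (N := Rmax (Rabs (u - x)) (Rabs (v - y))) in *.
    assert (HN : 0 <= N).
    { apply Rle_trans with (Rabs (u - x)); [apply Rabs_pos | apply Rmax_l]. }
    assert (eps / 2 * Cmod dz <= eps * N).
    { replace (eps * N) with (eps / 2 * (2 * N)) by field.
      apply Rmult_le_compat_l; [lra |]. nra. }
    split; lra. }
  exists q, p, (- q). split; intros eps; destruct (K eps) as [d Hd];
    exists d; intros u v Hu Hv; apply (Hd u v Hu Hv).
Qed.

(** Each exceptional time in the interval is removed by splitting there and
    using continuity; between them the mean value theorem applies. *)
Lemma eq_of_derive_zero (g : R -> R) (E : list R) :
  (forall t, continuous g t) ->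
  forall a b, a <= b ->
  (forall t, a < t < b -> ~ In t E -> is_derive g t 0) -> g a = g b.
Proof.
  intros Hg. induction E as [| e E IH]; intros a b Hab HE.
  - destruct (MVT_gen g a b (fun _ => 0)) as [c [_ Hc]].
    + rewrite Rmin_left, Rmax_right by lra. intros t Ht. apply HE; auto.
    + intros t _. apply continuity_pt_filterlim, Hg.
    + lra.
  - destruct (Rlt_dec a e) as [H1 | H1]; [destruct (Rlt_dec e b) as [H2 | H2] |].
    + transitivity (g e).
      * apply IH; [lra |]. intros t Ht Hn. apply HE; [lra |].
        intros [<- | H]; [lra | tauto].
      * apply IH; [lra |]. intros t Ht Hn. apply HE; [lra |].
        intros [<- | H]; [lra | tauto].
    + apply IH; [lra |]. intros t Ht Hn. apply HE; [lra |].
      intros [<- | H]; [lra | tauto].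
    + apply IH; [lra |]. intros t Ht Hn. apply HE; [lra |].
      intros [<- | H]; [lra | tauto].
Qed.

(** A trajectory is only continuous relatively to its time interval; composing with
    [clamp] extends it by its end values to a function continuous on R, without
    changing it near interior points. *)
Definition clamp (T t : R) : R := Rmax 0 (Rmin T t).

Lemma clamp_id (T t : R) : 0 <= t <= T -> clamp T t = t.
Proof. intros H; unfold clamp. rewrite Rmin_right, Rmax_right; lra. Qed.

Lemma continuous_clamp (T : R) (x : R -> R) :
  0 <= T -> continuous_on (fun t => 0 <= t <= T) x ->
  forall t, continuous (fun t => x (clamp T t)) t.
Proof.
  intros HT Hx t.
  assert (Hin : forall s, 0 <= clamp T s <= T).
  { intros s; unfold clamp, Rmax, Rmin.
    repeat destruct (Rle_dec _ _); lra. }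
  eapply filterlim_comp; [| apply Hx, Hin].
  intros S [d Hd]. exists d. intros s Hs.
  apply Hd; [| apply Hin].
  assert (Hs' : Rabs (s - t) < d) by exact Hs.
  change (Rabs (clamp T s - clamp T t) < d).
  apply Rle_lt_trans with (2 := Hs').
  unfold clamp, Rmax, Rmin. repeat destruct (Rle_dec _ _);
    apply Rabs_le; generalize (Rle_abs (s - t)) (Rle_abs (- (s - t)));
    rewrite Rabs_Ropp; lra.
Qed.

Lemma trajectory_invariant (f1 f2 : R -> R -> R) (T : R)
  (u1 u2 x1 x2 x3 : R -> R) :
  closed_form f1 f2 -> 0 < T -> trajectory f1 f2 T u1 u2 x1 x2 x3 ->
  x3 0 - potential f1 f2 (x1 0) (x2 0) = x3 T - potential f1 f2 (x1 T) (x2 T).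
Proof.
  intros Hcl HT (C1 & C2 & C3 & E & HE).
  pose (g := fun t => x3 (clamp T t)
    - potential f1 f2 (x1 (clamp T t)) (x2 (clamp T t))).
  assert (Hg : g 0 = g T).
  { apply (eq_of_derive_zero g E); [| lra |].
    - intros t.
      apply (continuous_minus (fun t => x3 (clamp T t))
        (fun t => potential f1 f2 (x1 (clamp T t)) (x2 (clamp T t)))).
      + apply continuous_clamp; [lra | exact C3].
      + apply (continuous_comp_2 (fun t => x1 (clamp T t)) (fun t => x2 (clamp T t))
          (potential f1 f2)).
        * apply continuous_clamp; [lra | exact C1].
        * apply continuous_clamp; [lra | exact C2].
        * apply continuity_2d_pt_filterlim, differentiable_continuity_pt.
          eexists; eexists; apply potential_differentiable; exact Hcl.
    - intros t Ht Hn. destruct (HE t Ht Hn) as (D1 & D2 & D3).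
      apply (is_derive_ext_loc (fun t => x3 t - potential f1 f2 (x1 t) (x2 t))).
      + generalize (open_and _ _ (open_gt 0) (open_lt T) t Ht).
        apply filter_imp. intros s Hs. unfold g. rewrite clamp_id; [reflexivity | lra].
      + apply is_derive_Reals in D1. apply is_derive_Reals in D2.
        assert (DP := derivable_pt_lim_comp_2d _ x1 x2 t _ _ _ _
          (potential_differentiable f1 f2 (x1 t) (x2 t) Hcl) D1 D2).
        apply is_derive_Reals in DP.
        assert (DM := is_derive_minus _ _ _ _ _ D3 DP).
        rewrite minus_eq_zero in DM. exact DM. }
  unfold g in Hg. rewrite !clamp_id in Hg by lra. exact Hg.
Qed.

Theorem lemmaV1 (f1 f2 : R -> R -> R) (F : C -> C)
  (HF : forall x1 x2 : R, F (x1 + Ci * x2)%C = (f2 x1 x2 + Ci * f1 x1 x2)%C) :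
  holomorphic F -> uncontrollable f1 f2.
Proof.
  intros Hol Hctrl.
  assert (Hcl := holomorphic_closed_form f1 f2 F HF Hol).
  destruct (Hctrl (0, 0, 0) (0, 0, 1))
    as (T & u1 & u2 & x1 & x2 & x3 & HT & _ & _ & Htraj & E0 & ET).
  assert (H := trajectory_invariant _ _ _ _ _ _ _ _ Hcl HT Htraj).
  injection E0 as E1 E2 E3. injection ET as E1' E2' E3'.
  rewrite E1, E2, E3, E1', E2', E3' in H. lra.
Qed.
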